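(* Let $P\ge 1$, $M\ge 1$ and $1\le L\le M$ be integers. In the continue-on-completion cooperative coupon game with $P$ players, $M$ labels and lots of $L$ coupons, independently of the statistics of lot drawing (that is, for every admissible lot distribution), the average number of transferred coupons is $$\mathcal{C}^{\rm tra}=\frac{M}{2}(P-1).$$
   Context: The game. $P$ players collect coupons, each carrying one of $M$ labels; initially nobody has a coupon. Each player's local goal is to own one coupon of every label; the common goal is that all players reach their local goal. The game proceeds in bursts. In each burst a lot of $L$ coupons with pairwise different labels enters the system. Lots are drawn independently of each other and of all other random choices, from a common probability distribution on the $L$-element subsets of the label set (the lot distribution); it is admissible if every label has positive probability of belonging to a lot. The whole lot is assigned to one player, selected independently each time and uniformly among all $P$ players. That player retains the coupons of the lot whose labels she misses and offers every other (duplicate) coupon of the lot to the other players. Each player missing the label of an offered coupon issues one request for it. If there is at least one request, the coupon is assigned uniformly at random (independently for different coupons) to one of the requesting players and transferred to her (one transfer); if there is no request it is discarded. In the continue-on-completion game all $P$ players remain active until the common goal is reached, even if they have completed their own collections. No new burst is started once the common goal has been achieved. $\mathcal{C}^{\rm tra}$ is the expected total number of transferred coupons over the whole game until the common goal is reached. *)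

(* Defs.v *)
(* MathComp-Analysis *)
From HB Require Import structures.
From mathcomp Require Import all_boot all_order all_algebra.
From mathcomp Require Import all_classical all_reals all_analysis.

Set Implicit Arguments.
Unset Strict Implicit.
Unset Printing Implicit Defensive.

Import Order.TTheory GRing.Theory Num.Theory.
Local Open Scope ring_scope.

(* S i is the set of labels owned by player i. *)
Definition state (P M : nat) := {ffun 'I_P -> {set 'I_M}}.

(* (lot, player the lot is assigned to, recipients): the recipient map sends a
   label to Some j if the coupon with that label was transferred to player j,
   and to None if there was no transfer of that label in the burst. *)
Definition burst (P M : nat) : finType :=
  ({set 'I_M} * 'I_P * {ffun 'I_M -> option 'I_P})%type.

Section Game.
Variables (P M : nat).
Implicit Types (S : state P M) (b : burst P M).

Definition lot b : {set 'I_M} := b.1.1.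
Definition player b : 'I_P := b.1.2.
Definition recipient b : {ffun 'I_M -> option 'I_P} := b.2.

Definition initial_state : state P M := [ffun=> finset.set0].

Definition common_goal S : bool := [forall i, S i == [set: 'I_M]].

Definition offered S (i : 'I_P) (A : {set 'I_M}) : {set 'I_M} := A :&: S i.

Definition requesters S (i : 'I_P) (m : 'I_M) : {set 'I_P} :=
  [set j | (j != i) && (m \notin S j)].

Definition next_state S b : state P M :=
  [ffun j => S j :|: (if j == player b then lot b else finset.set0)
                 :|: [set m | recipient b m == Some j]].

Definition transfers b : nat := #|[set m | recipient b m != None]|.

Fixpoint state_at (h : nat -> burst P M) (n : nat) : state P M :=
  if n is n'.+1 then next_state (state_at h n') (h n') else initial_state.

Variable R : realType.

Definition lot_distribution (L : nat) (p : {set 'I_M} -> R) : Prop :=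
  [/\ forall A : {set 'I_M}, 0 <= p A,
      forall A : {set 'I_M}, #|A| != L -> p A = 0
    & \sum_(A : {set 'I_M}) p A = 1].

Definition admissible (p : {set 'I_M} -> R) : Prop :=
  forall m : 'I_M, 0 < \sum_(A : {set 'I_M} | m \in A) p A.

(* Law of the recipient of label m when lot A is assigned to player i. *)
Definition recipient_law S (i : 'I_P) (A : {set 'I_M}) (m : 'I_M)
    (r : option 'I_P) : R :=
  let Q := requesters S i m in
  if (m \in offered S i A) && (Q != finset.set0)
  then (if r is Some j then (j \in Q)%:R / #|Q|%:R else 0)
  else (r == None)%:R.

(* Conditional law, given that the current state is S, of the next burst; the
   product form expresses that the lot is independent of the player and that
   the assignments of different offered coupons are independent. *)
Definition burst_law (p : {set 'I_M} -> R) S b : R :=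
  p (lot b) * P%:R^-1 *
  \prod_(m : 'I_M) recipient_law S (player b) (lot b) m (recipient b m).

Variables (d : measure_display) (T : measurableType d) (Pr : probability T R).

(* B n is the n-th burst. The conditional law of a burst given the entire past
   is prescribed only as long as the common goal has not been reached: from
   then on there are no bursts and the values of B n are irrelevant. *)
Definition coupon_game (p : {set 'I_M} -> R) (B : nat -> T -> burst P M) :
    Prop :=
  (forall n b, measurable [set w | B n w = b]%classic) /\
  (forall (n : nat) (h : nat -> burst P M), ~~ common_goal (state_at h n) ->
     Pr [set w | forall k, (k < n.+1)%N -> B k w = h k]%classic =
     (Pr [set w | forall k, (k < n)%N -> B k w = h k]%classic *
      (burst_law p (state_at h n) (h n))%:E)%E).

Definition total_transfers (B : nat -> T -> burst P M) (w : T) : \bar R :=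
  (\sum_(0 <= n <oo)
     (if common_goal (state_at (fun k => B k w) n) then 0
      else (transfers (B n w))%:R%:E))%E.

Definition expected_transfers (B : nat -> T -> burst P M) : \bar R :=
  (\int[Pr]_w total_transfers B w)%E.

End Game.

(* Main.v *)
(* As long as k < P players own a label, the next coupon with this label finds
   a new owner, and is transferred exactly when the player drawing the lot is
   one of the k current owners, which has probability k / P. Hence, if k_m
   denotes the number of owners of m, the number of transfers so far minus
   \sum_m k_m (k_m - 1) / (2 P) is a martingale, and the sum equals
   M (P - 1) / 2 at the end. The game ends almost surely because, weighting
   k_m by the inverse of the probability that m is in a lot, the sum of the k_m
   grows in mean by at least 1 per burst while it stays bounded. *)
Require Import Defs.
From HB Require Import structures.
From mathcomp Require Import all_boot all_order all_algebra.
From mathcomp Require Import all_classical all_reals all_analysis.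
From mathcomp Require Import measurable_realfun ring.

Set Implicit Arguments.
Unset Strict Implicit.
Unset Printing Implicit Defensive.

Import Order.TTheory GRing.Theory Num.Theory.
Import numFieldNormedType.Exports.
Local Open Scope ring_scope.

(** * Owner counts of labels and their one-burst drift *)

Section Drift.
Variables (R : realType) (P M : nat).
Implicit Types (S : state P M) (b : burst P M) (i : 'I_P) (m : 'I_M).
Implicit Types (A : {set 'I_M}) (r : option 'I_P).

(** A state stores label sets per player; this is its transpose, since the potentials below count
    owners per label. *)
Definition owners S m : {set 'I_P} := [set j | m \in S j].

Definition owners_after S i A m r : {set 'I_P} :=
  owners S m :|: (if m \in A then [set i] else finset.set0)
             :|: [set j | r == Some j].

Lemma owners_next_state S b m :
  owners (next_state S b) m =
  owners_after S (player b) (lot b) m (recipient b m).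
Proof.
apply/setP => j; rewrite !inE ffunE !inE; congr (_ || _ || _).
by case: eqP => [->|/eqP/negbTE jb]; case: ifP => mA; rewrite !inE ?mA ?jb ?eqxx.
Qed.

(** Makes goal states absorbing, so the unprescribed values of the bursts after the end of the game
    are harmless. *)
Lemma next_state_goal S b : common_goal S -> next_state S b = S.
Proof.
move=> /forallP gS; apply/ffunP => j; rewrite ffunE (eqP (gS j)).
by rewrite !finset.setTU.
Qed.

Lemma common_goalE S :
  common_goal S = [forall m, owners S m == [set: 'I_P]].
Proof.
apply/forallP/forallP => [h m|h i]; apply/eqP/setP => x; rewrite !inE.
  by rewrite (eqP (h x)) inE.
by have /eqP/setP/(_ i) := h x; rewrite !inE.
Qed.

Lemma setC_neq0 (I : finType) (Q : {set I}) :
  (~: Q != finset.set0) = (Q != [set: I]).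
Proof. by rewrite -finset.setCT (inj_eq (@finset.setC_inj _)). Qed.

Lemma requesters_owner S i m : m \in S i -> requesters S i m = ~: owners S m.
Proof.
move=> mi; apply/setP => j; rewrite !inE.
by case: (altP (j =P i)) => // ->; rewrite mi.
Qed.

Lemma big_option (I : finType) (F : option I -> R) :
  \sum_r F r = F None + \sum_j F (Some j).
Proof.
rewrite (bigD1 None) //=; congr (_ + _).
rewrite (reindex_omap Some id) /=; last by case.
by apply: eq_bigl => j; rewrite eqxx.
Qed.

Lemma sum_recipient_law_None S i A m (F : option 'I_P -> R) :
  ~~ ((m \in offered S i A) && (requesters S i m != finset.set0)) ->
  \sum_r recipient_law R S i A m r * F r = F None.
Proof.
move=> /negbTE h; rewrite big_option /recipient_law h eqxx mul1r.
by rewrite big1 ?addr0 // => j _; rewrite mul0r.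
Qed.

Lemma sum_recipient_law_Some S i A m (F : option 'I_P -> R) :
  m \in A -> m \in S i -> owners S m != [set: 'I_P] ->
  \sum_r recipient_law R S i A m r * F r =
  (\sum_(j in ~: owners S m) F (Some j)) / #|~: owners S m|%:R.
Proof.
move=> mA mi nT; rewrite big_option /recipient_law requesters_owner // inE mA mi.
rewrite setC_neq0 nT mul0r add0r mulr_suml [RHS]big_mkcond; apply: eq_bigr => j _ /=.
by case: ifP => _; rewrite ?mul0r // mul1r mulrC.
Qed.

(** If [m] is drawn and not yet owned by everybody, the owner count rises by exactly one whoever the
    new owner is: [i] herself without transfer if she misses [m], otherwise a requester after one
    transfer. In all other cases nothing changes. The parameter [t] is the price of a transfer. *)
Lemma recipient_law_drift S i A m (G : nat -> R) (t : R) :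
  \sum_r recipient_law R S i A m r *
    (G #|owners_after S i A m r| - G #|owners S m| - t * (r != None)%:R) =
  if (m \in A) && (owners S m != [set: 'I_P])
  then G #|owners S m|.+1 - G #|owners S m| - t * (m \in S i)%:R else 0.
Proof.
have nN : [set j : 'I_P | None == Some j] = finset.set0.
  by apply/setP => j; rewrite !inE.
case: (boolP (m \in A)) => mA /=; last first.
  rewrite sum_recipient_law_None ?inE ?(negbTE mA) //.
  by rewrite /owners_after (negbTE mA) nN !finset.setU0 subrr sub0r mulr0 oppr0.
case: (boolP (m \in S i)) => mi; last first.
  rewrite sum_recipient_law_None ?inE ?(negbTE mi) ?andbF //.
  have -> : owners S m != [set: 'I_P].
    by apply/eqP => /setP /(_ i); rewrite !inE (negbTE mi).
  by rewrite /owners_after mA nN finset.setU0 finset.setUC cardsU1 inE mi.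
have Ui r : owners_after S i A m r = owners S m :|: [set j | r == Some j].
  congr (_ :|: _); rewrite mA; apply/finset.setUidPl; apply/fintype.subsetP => j.
  by rewrite !inE => /eqP ->.
case: (altP (owners S m =P [set: 'I_P])) => oT /=.
  rewrite sum_recipient_law_None ?requesters_owner ?oT ?finset.setCT ?eqxx ?andbF //.
  by rewrite Ui nN finset.setU0 oT subrr sub0r mulr0 oppr0.
rewrite sum_recipient_law_Some //.
under eq_bigr => j /=.
  rewrite inE => jo.
  have -> : #|owners_after S i A m (Some j)| = #|owners S m|.+1.
    rewrite Ui; have -> : [set j0 | Some j == Some j0] = [set j].
      by apply/setP => k; rewrite !inE eq_sym.
    by rewrite finset.setUC cardsU1 jo.
  over.
by rewrite /= sumr_const -[X in X / _]mulr_natr mulfK // pnatr_eq0 cards_eq0 setC_neq0.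
Qed.

Lemma sum_recipient_law S i A m : \sum_r recipient_law R S i A m r = 1.
Proof.
under eq_bigr do rewrite -[recipient_law _ _ _ _ _ _]mulr1.
case: (boolP ((m \in offered S i A) && (requesters S i m != finset.set0))).
  rewrite inE => /andP[/andP[mA mi]]; rewrite requesters_owner // => Q0.
  rewrite sum_recipient_law_Some -?setC_neq0 //.
  by rewrite sumr_const mulfV // pnatr_eq0 cards_eq0.
by move=> h; rewrite sum_recipient_law_None.
Qed.

(** Marginal of a product law: once [F] is absorbed into factor [i], distributivity splits the sum,
    and the other factors sum to 1. *)
Lemma sum_prod_marginal (I J : finType) (q : I -> J -> R) (i : I) (F : J -> R) :
  (forall k, \sum_j q k j = 1) ->
  \sum_(f : {ffun I -> J}) (\prod_k q k (f k)) * F (f i) = \sum_j q i j * F j.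
Proof.
move=> q1.
transitivity (\sum_(f : {ffun I -> J})
    \prod_k (q k (f k) * (if k == i then F (f k) else 1))).
  apply: eq_bigr => f _; rewrite big_split /=; congr (_ * _).
  by rewrite -big_mkcond big_pred1_eq.
rewrite -(bigA_distr_bigA (fun k j => q k j * (if k == i then F j else 1))).
rewrite (bigD1 i) //= eqxx [X in _ * X]big1 ?mulr1 // => k /negbTE ->.
by under eq_bigr do rewrite mulr1.
Qed.

Section Law.
Variable p : {set 'I_M} -> R.

Lemma sum_burst S (F : burst P M -> R) :
  \sum_b burst_law p S b * F b =
  \sum_A p A * (P%:R^-1 * \sum_i \sum_(f : {ffun 'I_M -> option 'I_P})
    (\prod_m recipient_law R S i A m (f m)) * F (A, i, f)).
Proof.
transitivity (\sum_A \sum_i \sum_f burst_law p S (A, i, f) * F (A, i, f)).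
  by rewrite pair_bigA /= pair_bigA /=; apply: eq_bigr => [[[A i] f] _].
apply: eq_bigr => A _; rewrite mulrA mulr_sumr; apply: eq_bigr => i _.
by rewrite mulr_sumr; apply: eq_bigr => f _; rewrite mulrA.
Qed.

Definition lot_prob m : R := \sum_(A : {set 'I_M} | m \in A) p A.

Definition potential (g : 'I_M -> nat -> R) S : R := \sum_m g m #|owners S m|.

Lemma potential_goal (g : 'I_M -> nat -> R) S :
  common_goal S -> potential g S = \sum_m g m P.
Proof.
rewrite common_goalE => /forallP gS; apply: eq_bigr => m _.
by rewrite (eqP (gS m)) cardsT card_ord.
Qed.

Lemma transfersE b : (transfers b)%:R = \sum_m (recipient b m != None)%:R :> R.
Proof.
rewrite /transfers -sum1_card natr_sum big_mkcond; apply: eq_bigr => m _.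
by rewrite inE; case: ifP.
Qed.

(** By linearity the labels contribute separately, so only the marginal law of each recipient
    matters. It is used with [t = 0] for termination and [t = 1] for counting transfers. *)
Lemma potential_drift (g : 'I_M -> nat -> R) (t : R) S : (0 < P)%N ->
  \sum_b burst_law p S b *
    (potential g (next_state S b) - potential g S - t * (transfers b)%:R) =
  \sum_(m | owners S m != [set: 'I_P]) lot_prob m *
    (g m #|owners S m|.+1 - g m #|owners S m| - t * (#|owners S m|%:R / P%:R)).
Proof.
move=> P0; have Pn0 : P%:R != 0 :> R by rewrite pnatr_eq0 -lt0n.
pose D m i A r := g m #|owners_after S i A m r| - g m #|owners S m|
                  - t * (r != None)%:R.
transitivity (\sum_b burst_law p S b *
    \sum_m D m (player b) (lot b) (recipient b m)).
  apply: eq_bigr => b _; congr (_ * _).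
  rewrite transfersE mulr_sumr -!sumrB; apply: eq_bigr => m _.
  by rewrite owners_next_state.
rewrite sum_burst /=.
transitivity (\sum_A \sum_m p A * (P%:R^-1 * \sum_i
    if (m \in A) && (owners S m != [set: 'I_P])
    then g m #|owners S m|.+1 - g m #|owners S m| - t * (m \in S i)%:R else 0)).
  apply: eq_bigr => A _; rewrite -mulr_sumr -mulr_sumr; congr (_ * (_ * _)).
  rewrite [RHS]exchange_big /=; apply: eq_bigr => i _.
  under eq_bigr do rewrite mulr_sumr.
  rewrite exchange_big /=; apply: eq_bigr => m _.
  rewrite -recipient_law_drift -/(D m i A) -sum_prod_marginal //.
  by move=> k; exact: sum_recipient_law.
rewrite exchange_big [RHS]big_mkcond /=; apply: eq_bigr => m _.
case: ifPn => oT; last first.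
  by rewrite big1 // => A _; rewrite andbF big1 ?mulr0.
rewrite /lot_prob mulr_suml [RHS]big_mkcond; apply: eq_bigr => A _ /=.
case: ifP => mA /=; last by rewrite big1 ?mulr0.
(* Averaging over the uniform player: the terms free of [i] are unchanged, and the indicators of
   [m \in S i] add up to the number of owners. *)
congr (_ * _); rewrite sumrB sumr_const card_ord -mulr_sumr mulrBr.
rewrite -[X in _ * X - _]mulr_natl mulKf //; congr (_ - _).
rewrite -sum1_card natr_sum [in RHS]big_mkcond /= mulrCA [_^-1 * _]mulrC.
congr (_ * (_ / _)); apply: eq_bigr => i _.
by rewrite inE; case: ifP.
Qed.

End Law.
End Drift.

(** * Random variables with values in a finite type, handled through their fibers *)

Section FiniteValued.
Context d (T : measurableType d) (R : realType) (Pr : probability T R).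
Variables (F : finType) (Z : T -> F).
Hypothesis mZ : forall z, measurable [set w | Z w = z]%classic.

Lemma measurable_fiber_pred (Q : F -> Prop) :
  measurable [set w | Q (Z w)]%classic.
Proof.
have -> : [set w | Q (Z w)]%classic =
    (\bigcup_(z in [set z | Q z]) [set w | Z w = z])%classic.
  apply/seteqP; split => w /= => [Qw|[z Qz Zz]]; last by rewrite Zz.
  by exists (Z w).
by apply: fin_bigcup_measurable => // z _; exact: mZ.
Qed.

Lemma measurable_fun_fiber (f : F -> R) :
  measurable_fun setT ((fun w => (f (Z w))%:E) : T -> \bar R).
Proof.
by move=> _ Y mY; rewrite setTI; exact: (measurable_fiber_pred (fun z => Y (f z)%:E)).
Qed.

(** [f (Z w)] is a finite sum of multiples of the indicators of the fibers of [Z]. *)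
Lemma integral_finite_valued (f : F -> R) : (forall z, 0 <= f z) ->
  (\int[Pr]_w (f (Z w))%:E =
   (\sum_z f z * fine (Pr [set w | Z w = z]%classic))%:E)%E.
Proof.
move=> f0.
have mI z : measurable_fun setT
    ((fun w => ((f z)%:E * (\1_[set w | Z w = z]%classic w)%:E)%E) : T -> \bar R).
  apply: emeasurable_funM => //; apply/measurable_EFinP.
  exact/measurable_indicP.
have fI z w : (0 <= (f z)%:E * (\1_[set w | Z w = z]%classic w)%:E :> \bar R)%E.
  by rewrite mule_ge0 // lee_fin.
transitivity (\int[Pr]_w (\sum_z (f z)%:E * (\1_[set w | Z w = z]%classic w)%:E)%E)%E.
  apply: eq_integral => w _; rewrite (bigD1 (Z w)) //= indicE mem_set //.
  rewrite mule1 big1 ?adde0 // => z zw; rewrite indicE memNset ?mule0 //=.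
  by move=> e; rewrite e eqxx in zw.
rewrite ge0_integral_sum // -sumEFin; apply: eq_bigr => z _.
rewrite ge0_integralZl //; last 2 first.
- by apply/measurable_EFinP/measurable_indicP.
- by rewrite lee_fin.
by rewrite integral_indic // setIT EFinM fineK // fin_num_measure.
Qed.

Lemma prob_finite_valued (Q : pred F) :
  fine (Pr [set w | Q (Z w)]%classic) =
  \sum_(z | Q z) fine (Pr [set w | Z w = z]%classic).
Proof.
have mQ := measurable_fiber_pred Q.
have /(congr1 fine) := integral_finite_valued (fun z => ler0n R (Q z)).
have -> : \sum_z (Q z)%:R * fine (Pr [set w | Z w = z]%classic) =
    \sum_(z | Q z) fine (Pr [set w | Z w = z]%classic).
  rewrite [RHS]big_mkcond; apply: eq_bigr => z _.
  by case: (Q z); rewrite ?mul1r ?mul0r.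
move=> /= <-.
rewrite (eq_integral (fun w => (\1_[set w | Q (Z w)]%classic w)%:E)) => [|w _].
  by rewrite integral_indic // setIT.
rewrite indicE; case: (boolP (Q (Z w))) => h; first by rewrite mem_set.
by rewrite memNset //; exact/negP.
Qed.

End FiniteValued.

(** * Laws of the state and of the burst at a given time *)

Section Process.
Variables (R : realType) (P M : nat) (p : {set 'I_M} -> R).
Context d (T : measurableType d) (Pr : probability T R).
Variables (B : nat -> T -> burst P M).
Hypothesis hB : coupon_game Pr p B.

Let St n w : state P M := state_at (fun k => B k w) n.
Let mu n S : R := fine (Pr [set w | St n w = S]%classic).
Let joint n (Sb : state P M * burst P M) : R :=
  fine (Pr [set w | (St n w, B n w) = Sb]%classic).

Lemma measurable_pair_fiber (F G : finType) (Y : T -> F) (Z : T -> G) :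
  (forall y, measurable [set w | Y w = y]%classic) ->
  (forall z, measurable [set w | Z w = z]%classic) ->
  forall yz, measurable [set w | (Y w, Z w) = yz]%classic.
Proof.
move=> mY mZ [y z].
have -> : [set w | (Y w, Z w) = (y, z)]%classic =
    ([set w | Y w = y] `&` [set w | Z w = z])%classic.
  by apply/seteqP; split => w /= [-> ->].
exact: measurableI.
Qed.

Lemma measurable_burst n b : measurable [set w | B n w = b]%classic.
Proof. by case: hB => mB _; exact: mB. Qed.

Lemma measurable_state n S : measurable [set w | St n w = S]%classic.
Proof.
elim: n S => [|n IH] S.
  by case: (pselect (initial_state P M = S)) => h;
     [rewrite (_ : mkset _ = setT) | rewrite (_ : mkset _ = set0)] => //;
     apply/seteqP; split => w.
have mSB := measurable_pair_fiber IH (measurable_burst n).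
exact: (measurable_fiber_pred mSB (fun Sb => next_state Sb.1 Sb.2 = S)).
Qed.

Lemma measurable_joint n Sb : measurable [set w | (St n w, B n w) = Sb]%classic.
Proof.
exact: (measurable_pair_fiber (measurable_state n) (measurable_burst n)).
Qed.

(** Packing the past into a finite type turns conditioning on it into a finite sum. *)
Let history n w : {ffun 'I_n -> burst P M} := [ffun k : 'I_n => B k w].

(* The history h followed by b forever; only its value b at time n matters. *)
Definition extend n (h : {ffun 'I_n -> burst P M}) b (k : nat) : burst P M :=
  if (insub k : option 'I_n) is Some i then h i else b.

Lemma state_at_ext (h h' : nat -> burst P M) n :
  (forall k, (k < n)%N -> h k = h' k) -> state_at h n = state_at h' n.
Proof.
elim: n => //= n IH hh; rewrite IH => [|k kn]; last exact/hh/ltnW.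
by rewrite hh.
Qed.

Lemma historyP n w h b :
  history n w = h <-> (forall k, (k < n)%N -> B k w = extend h b k).
Proof.
split=> [<- k kn|hh]; first by rewrite /extend insubT ffunE.
apply/ffunP => k; rewrite ffunE hh // /extend insubT // => kn.
by congr (h _); exact: val_inj.
Qed.

Lemma measurable_history n h : measurable [set w | history n w = h]%classic.
Proof.
have -> : [set w | history n w = h]%classic =
    (\bigcap_(k in [set: 'I_n]) [set w | B k w = h k])%classic.
  apply/seteqP; split => w /= => [<- k _|hh]; first by rewrite /= ffunE.
  by apply/ffunP => k; rewrite ffunE; exact: hh.
by apply: fin_bigcap_measurable => // k _; exact: measurable_burst.
Qed.

(** The game prescribes the burst law given a whole history. All histories leading to [S] give the
    same factor [burst_law p S b], which comes out of the sum over them. *)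
Lemma joint_law n S b : ~~ common_goal S ->
  joint n (S, b) = mu n S * burst_law p S b.
Proof.
move=> gS; pose Q (h : {ffun 'I_n -> burst P M}) := state_at (extend h b) n == S.
have QP w : Q (history n w) <-> St n w = S.
  rewrite /Q (state_at_ext (h' := fun k => B k w)); first by split=> /eqP.
  by move=> k kn; apply/esym; exact: ((historyP w _ b).1 erefl k kn).
have -> : mu n S = \sum_(h | Q h) fine (Pr [set w | history n w = h]%classic).
  rewrite -prob_finite_valued; last exact: measurable_history.
  by congr (fine (Pr _)); apply/seteqP; split => w /QP.
have mhb := measurable_pair_fiber (@measurable_history n) (measurable_burst n).
transitivity (fine (Pr [set w | [pred hb | Q hb.1 && (hb.2 == b)]
                                  (history n w, B n w)]%classic)).
  congr (fine (Pr _)); apply/seteqP; split => w /=.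
    by move=> [/QP -> ->]; rewrite eqxx.
  by move=> /andP[/QP -> /eqP ->].
rewrite prob_finite_valued // mulr_suml.
transitivity (\sum_(h | Q h) \sum_(c | c == b)
    fine (Pr [set w | (history n w, B n w) = (h, c)]%classic)).
  by rewrite pair_big /=; apply: eq_bigr => [[]].
apply: eq_bigr => h Qh; rewrite big_pred1_eq.
(* Since [extend h b] equals [h] before time [n] and [b] at time [n], the two events of the
   hypothesis become fibers of [(history, B n)] and of [history]. *)
case: hB => _ /(_ n (extend h b)).
rewrite (eqP Qh) => /(_ gS).
have eb : extend h b n = b by rewrite /extend insubF // ltnn.
have -> : [set w | forall k, (k < n.+1)%N -> B k w = extend h b k]%classic =
    [set w | (history n w, B n w) = (h, b)]%classic.
  apply/seteqP; split => w /= => [hh|[/(historyP w h b) hh Bn] k].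
    congr (_, _); last by rewrite hh // eb.
    by apply/(historyP w h b) => k kn; exact/hh/ltnW.
  by rewrite ltnS leq_eqVlt => /orP[/eqP ->|/hh //]; rewrite eb.
have -> : [set w | forall k, (k < n)%N -> B k w = extend h b k]%classic =
    [set w | history n w = h]%classic.
  by apply/seteqP; split => w /= /(historyP w h b).
move=> ->; rewrite eb fineM //; apply: fin_num_measure.
exact: measurable_history.
Qed.

Lemma state_law_joint n S : mu n S = \sum_b joint n (S, b).
Proof.
transitivity (fine (Pr [set w | [pred Sb | Sb.1 == S] (St n w, B n w)]%classic)).
  by congr (fine (Pr _)); apply/seteqP; split => w /= /eqP.
rewrite (prob_finite_valued Pr (measurable_joint n)).
transitivity (\sum_(S1 | S1 == S) \sum_b joint n (S1, b)).
  by rewrite pair_big /=; apply: eq_big => [Sb|[]] //=; rewrite andbT.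
by rewrite big_pred1_eq.
Qed.

Lemma next_state_law n S' :
  mu n.+1 S' = \sum_(Sb | next_state Sb.1 Sb.2 == S') joint n Sb.
Proof.
rewrite -(prob_finite_valued Pr (measurable_joint n)
  [pred Sb | next_state Sb.1 Sb.2 == S']).
by congr (fine (Pr _)); apply/seteqP; split => w /= /eqP.
Qed.

Lemma state_law_ge0 n S : 0 <= mu n S.
Proof. exact: fine_ge0. Qed.

Lemma sum_state_law n : \sum_S mu n S = 1.
Proof.
rewrite -(prob_finite_valued Pr (measurable_state n) xpredT).
by rewrite (_ : mkset _ = setT) ?probability_setT //; apply/seteqP; split.
Qed.

(** Goal states are absorbing and cancel, so the joint law is needed only where [joint_law]
    determines it. *)
Lemma state_law_step n (f : state P M -> R) :
  \sum_S mu n.+1 S * f S - \sum_S mu n S * f S =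
  \sum_(S | ~~ common_goal S) mu n S *
    \sum_b burst_law p S b * (f (next_state S b) - f S).
Proof.
have -> : \sum_S mu n.+1 S * f S =
    \sum_S \sum_b joint n (S, b) * f (next_state S b).
  rewrite pair_bigA /=.
  (* Pairs of a state and a burst are grouped by the state they lead to. *)
  rewrite [RHS](partition_big
    (fun Sb : state P M * burst P M => next_state Sb.1 Sb.2) xpredT) //=.
  apply: eq_bigr => S _; rewrite next_state_law mulr_suml.
  by apply: eq_bigr => [[S1 b]] /= /eqP ->.
rewrite -sumrB [RHS]big_mkcond; apply: eq_bigr => S _.
rewrite state_law_joint mulr_suml -sumrB.
case: ifPn => [gS|/negPn gS].
  rewrite -state_law_joint mulr_sumr; apply: eq_bigr => b _.
  by rewrite joint_law // -mulrBr mulrA.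
by rewrite big1 // => b _; rewrite next_state_goal // subrr.
Qed.

Lemma expected_burst_transfers n :
  (\int[Pr]_w (if common_goal (St n w) then 0 else (transfers (B n w))%:R%:E) =
   (\sum_(S | ~~ common_goal S) mu n S *
     \sum_b burst_law p S b * (transfers b)%:R)%:E)%E.
Proof.
transitivity (\int[Pr]_w ((if common_goal (St n w) then 0
                           else (transfers (B n w))%:R) : R)%:E)%E.
  by apply: eq_integral => w _; case: ifP.
rewrite (integral_finite_valued Pr (measurable_joint n)
  (f := fun Sb => if common_goal Sb.1 then 0 else (transfers Sb.2)%:R)); last first.
  by move=> Sb; case: ifP.
congr (_%:E); rewrite [RHS]big_mkcond /=.
transitivity (\sum_S \sum_b (if common_goal S then 0
    else (transfers b)%:R) * joint n (S, b)).
  by rewrite pair_bigA /=; apply: eq_bigr => [[]].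
apply: eq_bigr => S _; case: (boolP (common_goal S)) => gS /=.
  by rewrite big1 // => b _; rewrite mul0r.
rewrite mulr_sumr; apply: eq_bigr => b _.
by rewrite joint_law // mulrC mulrA.
Qed.

(** * Almost sure termination and the expected number of transfers *)

Hypotheses (P0 : (0 < P)%N) (hadm : admissible p).

(** Probability that the game is still going on before burst [n]. *)
Let running n : R := \sum_(S | ~~ common_goal S) mu n S.

(* Weighting the owner counts by 1 / lot_prob makes the drift of this potential
   the number of labels not yet owned by everybody. *)
Definition coverage (m : 'I_M) (k : nat) : R := k%:R / lot_prob p m.

Lemma coverage_drift (S : state P M) : ~~ common_goal S ->
  1 <= \sum_b burst_law p S b *
         (potential coverage (next_state S b) - potential coverage S).
Proof.
(* A zero multiple of the transfers is inserted to match [potential_drift] with [t = 0]. *)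
move=> gS; under eq_bigr => b _ do
  rewrite -[X in _ * X]subr0 -[X in _ - X](mul0r (transfers b)%:R).
rewrite potential_drift //.
have -> : \sum_(m | owners S m != [set: 'I_P]) lot_prob p m *
    (coverage m #|owners S m|.+1 - coverage m #|owners S m| -
     0 * (#|owners S m|%:R / P%:R)) =
    \sum_(m | owners S m != [set: 'I_P]) 1.
  apply: eq_bigr => m _; have := hadm m; rewrite -/(lot_prob p m) => q0.
  by rewrite mul0r subr0 /coverage -mulrBl -natrB // subSnn mul1r divff // gt_eqF.
have [m mT] : exists m, owners S m != [set: 'I_P].
  by apply/existsP; rewrite -negb_forall -common_goalE.
by rewrite (bigD1 m) //= lerDl sumr_ge0.
Qed.

Lemma running_ge0 n : 0 <= running n.
Proof. by apply: sumr_ge0 => S _; exact: state_law_ge0. Qed.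

(** The mean coverage [E n] grows by at least [running n] per step and is bounded, so the series of
    [running] converges and its terms tend to 0. *)
Lemma running_cvg0 : (running @ \oo --> (0 : R))%classic.
Proof.
pose E n := \sum_S mu n S * potential coverage S.
have stepE n : running n <= E n.+1 - E n.
  rewrite /E state_law_step; apply: ler_sum => S gS.
  by rewrite ler_peMr ?state_law_ge0 ?coverage_drift.
have q0 m : 0 < lot_prob p m by exact: hadm.
have E0 n : 0 <= E n.
  apply: sumr_ge0 => S _; rewrite mulr_ge0 ?state_law_ge0 //.
  by apply: sumr_ge0 => m _; rewrite divr_ge0 // ltW.
have EK n : E n <= \sum_m coverage m P.
  rewrite -[leRHS]mul1r -(sum_state_law n) mulr_suml; apply: ler_sum => S _.
  rewrite ler_wpM2l ?state_law_ge0 //; apply: ler_sum => m _.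
  rewrite ler_wpM2r ?invr_ge0 ?(ltW (q0 m)) // ler_nat.
  by rewrite -[leqRHS]card_ord max_card.
apply: cvg_series_cvg_0; apply: nondecreasing_is_cvgn.
  by apply: nondecreasing_series => k _ _; exact: running_ge0.
exists (\sum_m coverage m P) => _ [n _ <-]; rewrite /series /=.
apply: (@le_trans _ _ (E n - E 0%N)); last by rewrite lerBlDr (le_trans (EK n)) // lerDl.
by rewrite -telescope_sumr // big_nat [leRHS]big_nat; apply: ler_sum => k _.
Qed.

(* The sum over j < k of the probability j / P that the coupon raising the owner
   count of a label from j to j + 1 is drawn by an owner, hence transferred. *)
Definition transfer_potential (_ : 'I_M) (k : nat) : R :=
  'C(k, 2)%:R / P%:R.

(** Pascal's rule gives ['C(k.+1, 2) - 'C(k, 2) = k], so for each label the potential gains [k / P],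
    exactly the chance of a transfer, and the drift with [t = 1] vanishes. *)
Lemma transfer_drift (S : state P M) :
  \sum_b burst_law p S b * (transfers b)%:R =
  \sum_b burst_law p S b * (potential transfer_potential (next_state S b)
                            - potential transfer_potential S).
Proof.
apply/esym/eqP; rewrite -subr_eq0 -sumrB.
under eq_bigr do rewrite -mulrBr -[(transfers _)%:R]mul1r.
rewrite potential_drift // big1 // => m _.
rewrite /transfer_potential binS bin1 natrD.
by rewrite -mulrBl addrAC subrr add0r mul1r subrr mulr0.
Qed.

(** [f] differs from [c] only while the game is running, and its deviation is bounded because there
    are finitely many states. *)
Lemma state_law_cvg (f : state P M -> R) (c : R) :
  (forall S, common_goal S -> f S = c) ->
  ((fun n => \sum_S mu n S * f S) @ \oo --> c)%classic.
Proof.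
move=> fc; pose C := \sum_S `|f S - c|.
have bnd n : `|\sum_S mu n S * f S - c| <= running n * C.
  rewrite -[X in _ - X]mul1r -(sum_state_law n) mulr_suml -sumrB.
  rewrite (le_trans (ler_norm_sum _ _ _)) // mulr_suml [leRHS]big_mkcond.
  apply: ler_sum => S _; rewrite -mulrBr normrM ger0_norm ?state_law_ge0 //.
  case: ifPn => [_|/negPn /fc ->]; last by rewrite subrr normr0 mulr0.
  rewrite ler_wpM2l ?state_law_ge0 // /C (bigD1 S) //= lerDl.
  by apply: sumr_ge0.
apply/subr_cvg0/norm_cvg0P.
apply: (@squeeze_cvgr _ _ _ _ (fun=> 0) (fun n => running n * C)).
- by near=> n; rewrite normr_ge0 bnd.
- exact: cvg_cst.
- by rewrite -(mul0r C); apply: cvgMr_tmp; exact: running_cvg0.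
Unshelve. all: by end_near. Qed.

Lemma expected_transfers_coupon_game :
  expected_transfers Pr B = (\sum_(m < M) transfer_potential m P)%:E.
Proof.
pose E n := \sum_S mu n S * potential transfer_potential S.
have mf n : measurable_fun setT ((fun w => if common_goal (St n w) then 0%E
    else (transfers (B n w))%:R%:E) : T -> \bar R).
  pose F (Sb : state P M * burst P M) : R :=
    if common_goal Sb.1 then 0 else (transfers Sb.2)%:R.
  apply: (eq_measurable_fun (fun w => (F (St n w, B n w))%:E)).
    by move=> w _; rewrite /F /=; case: ifP.
  exact: (measurable_fun_fiber (measurable_joint n)).
rewrite /expected_transfers /total_transfers integral_nneseries //; last first.
  by move=> n w _; case: ifP => // _; rewrite lee_fin.
(* After the exchange of integral and series, the partial sums telescope to the mean potential
   [E n]. *)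
have -> : (fun n => \sum_(0 <= k < n) \int[Pr]_w (if common_goal (St k w) then 0
    else (transfers (B k w))%:R%:E))%E = EFin \o E.
  apply/funext => n /=; transitivity (E n - E 0%N)%:E.
    rewrite -telescope_sumr // -sumEFin; apply: eq_bigr => k _.
    rewrite expected_burst_transfers state_law_step; congr (_%:E).
    by apply: eq_bigr => S _; rewrite transfer_drift.
  (* At time 0 the law sits on the initial state, where no label has an owner and the potential is
     0. *)
  congr (_%:E); rewrite [E 0%N]big1 ?subr0 // => S _.
  case: (altP (initial_state P M =P S)) => [<-|S0].
    rewrite /potential big1 ?mulr0 // => m _.
    rewrite (_ : owners _ m = finset.set0) ?cards0 ?/transfer_potential ?mul0r //.
    by apply/setP => j; rewrite !inE ffunE inE.
  rewrite /mu (_ : mkset _ = set0) ?measure0 ?mul0r //.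
  by apply/seteqP; split => w //= /eqP; rewrite (negbTE S0).
apply: cvg_lim => //; apply: cvg_EFin; first by near=> n.
apply: state_law_cvg => S; exact: potential_goal.
Unshelve. all: by end_near. Qed.

End Process.

Theorem theorem2 (R : realType) (P M L : nat)
    (hP : (1 <= P)%N) (hM : (1 <= M)%N) (hL : (1 <= L <= M)%N)
    (p : {set 'I_M} -> R)
    (hp : lot_distribution L p) (hadm : admissible p)
    (d : measure_display) (T : measurableType d) (Pr : probability T R)
    (B : nat -> T -> burst P M) (hB : coupon_game Pr p B) :
  expected_transfers Pr B = (M%:R / 2 * (P%:R - 1))%:E.
Proof.
rewrite (expected_transfers_coupon_game hB hP hadm) sumr_const card_ord.
congr (_%:E); rewrite /transfer_potential -mulr_natl.
have Pn0 : P%:R != 0 :> R by rewrite pnatr_eq0 -lt0n.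
(* This identity reads [P * (P - 1) = 2 * 'C(P, 2)]; [1 <= P] lets the natural subtraction pass to
   [R]. *)
have := congr1 (fun n => n%:R : R) (mul_bin_diag P 1).
rewrite /= bin1 !natrM -subn1 natrB // => h.
have -> : 'C(P, 2)%:R = P%:R * (P%:R - 1) / 2 :> R by rewrite h mulrC mulKf.
by field.
Qed.
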